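(* Let $S\subseteq\mathbb{F}_2^n$ be a Sidon set of affine dimension $n$, and let $s=|S|$. Then $\gamma_S$ is bent if and only if $s=2^{n/2}$ and $S$ is a $k$-cover. If so, then $S$ is a $\left(\frac{2^{n/2}-2}{6}\right)$-cover.
   Context: A set $S\subseteq\mathbb{F}_2^n$ is Sidon if whenever $a+b=c+d$ with $a,b,c,d\in S$, $a\neq b$, $c\neq d$, then $\{a,b\}=\{c,d\}$. Affine dimension: $d$ where $d+1$ is the largest size of an affinely independent subset (no element is a sum of an odd number of the others). For $p\notin S$, $\mathrm{mult}_S(p)$ is the number of $3$-element subsets $\{x,y,z\}\subseteq S$ with $x+y+z=p$; a Sidon set is a $k$-cover if there is an integer $k>0$ with $\mathrm{mult}_S(p)=k$ for all $p\notin S$. $\gamma_S(a)=1$ if $a\neq0$ and $(a+S)\cap S\neq\emptyset$, else $0$. A Boolean function $f:\mathbb{F}_2^n\to\mathbb{F}_2$ is bent if $\bigl|\sum_{x\in\mathbb{F}_2^n}(-1)^{f(x)+a\cdot x}\bigr|=2^{n/2}$ for all $a\in\mathbb{F}_2^n$.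
   Formalization: The dimensions n = 2 and n = 4 are excluded: there S = {0, e_1, ..., e_n} has γ_S bent but s = n+1 ≠ 2^{n/2}. The final claim on the cover constant is stated for n > 0, since at n = 0 the constant (2^{n/2}-2)/6 = -1/6 is not a positive integer. *)

(* Defs.v *)
From mathcomp Require Import all_boot all_order all_algebra.
From mathcomp Require Import reals exp.

Set Implicit Arguments.
Unset Strict Implicit.
Unset Printing Implicit Defensive.

Import GRing.Theory.
Local Open Scope ring_scope.

Definition sidon (n : nat) (S : {set 'rV['F_2]_n}) : Prop :=
  forall a b c d : 'rV['F_2]_n,
    a \in S -> b \in S -> c \in S -> d \in S ->
    a + b = c + d -> a != b -> c != d -> [set a; b] = [set c; d].

Definition affindep (n : nat) (A : {set 'rV['F_2]_n}) : bool :=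
  [forall x in A, forall B : {set 'rV['F_2]_n},
     (B \subset A :\ x) && odd #|B| ==> (\sum_(y in B) y != x)].

(* Integer-valued, so that the empty set has dimension -1 and not 0. *)
Definition affdim (n : nat) (S : {set 'rV['F_2]_n}) : int :=
  (\max_(A : {set 'rV['F_2]_n} | (A \subset S) && affindep A) #|A|)%N%:Z - 1.

Definition mult (n : nat) (S : {set 'rV['F_2]_n}) (p : 'rV['F_2]_n) : nat :=
  #|[set T : {set 'rV['F_2]_n} |
      [&& T \subset S, #|T| == 3%N & \sum_(x in T) x == p]]|.

Definition is_cover (n : nat) (k : nat) (S : {set 'rV['F_2]_n}) : Prop :=
  [/\ sidon S, (0 < k)%N
    & forall p : 'rV['F_2]_n, p \notin S -> mult S p = k].

Definition gamma (n : nat) (S : {set 'rV['F_2]_n}) (a : 'rV['F_2]_n) : 'F_2 :=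
  if (a != 0) && ([set a + x | x in S] :&: S != set0) then 1 else 0.

Definition dotp (n : nat) (a x : 'rV['F_2]_n) : 'F_2 :=
  \sum_(i < n) a 0 i * x 0 i.

(* The exponent is the element f x + a . x of 'F_2, coerced to nat. *)
Definition walsh (R : realType) (n : nat) (f : 'rV['F_2]_n -> 'F_2)
    (a : 'rV['F_2]_n) : R :=
  \sum_(x : 'rV['F_2]_n) (-1) ^+ nat_of_ord (f x + dotp a x).

(* The real power 2^(n/2): irrational for odd n, hence no bent function then. *)
Definition pow2half (R : realType) (n : nat) : R := 2 `^ (n%:R / 2).

Definition bent (R : realType) (n : nat) (f : 'rV['F_2]_n -> 'F_2) : Prop :=
  forall a : 'rV['F_2]_n, `|walsh R f a| = pow2half R n.

(* Main.v *)
(* Put F(a) = sum_(x in S) (-1)^(a.x).  As S is Sidon, every nonzero a is a sum of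
   two elements of S in exactly 0 or 2 ways, which gives F(a)^2 = s + 2^n [a = 0]
   - W(a) with W the Walsh transform of gamma_S.  So, with q = 2^(n/2), bentness
   reads W(a) = q or - q for all a, and a = 0 leaves only s = q or s = q + 1.

   If s = q + 1 then F(a)^2 is 1 or 2q + 1 for a <> 0.  The value 2q + 1 is a
   square only for q = 4, and if F(a)^2 = 1 for all a <> 0, Parseval gives q = 2.

   If s = q then F(a)^3 = 2q F(a) for a <> 0, and Fourier inversion of F^3 shows
   that each p outside S is a sum x + y + z over S in q - 2 = 6 mult_S(p) ordered
   ways.  Conversely each p in S has 3s - 2 such representations, so for a k-cover
   with s = q, F(a)^3 = 6k 2^n [a = 0] + (3q - 2 - 6k) F(a); a = 0 yields
   6k = q - 2 and then F(a)^2 is 0 or 2q, i.e. W(a) = q or - q, for a <> 0. *)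
Require Import Defs.
From mathcomp Require Import all_boot all_order all_algebra.
From mathcomp Require Import reals exp.
From mathcomp Require Import zify ring.

Set Implicit Arguments.
Unset Strict Implicit.
Unset Printing Implicit Defensive.

Import Order.TTheory GRing.Theory Num.Theory.
Local Open Scope ring_scope.

(** * Signs of bits, and arithmetic of powers of two *)

Definition signF2 (u : 'F_2) : int := (-1) ^+ nat_of_ord u.

Lemma F2_cases (u : 'F_2) : u = 0 \/ u = 1.
Proof. by case: u => -[|[|//]] i; [left|right]; apply: val_inj. Qed.

Lemma signF2D (u v : 'F_2) : signF2 (u + v) = signF2 u * signF2 v.
Proof. by case: (F2_cases u) => ->; case: (F2_cases v) => ->. Qed.

Lemma odd_dvd_pow2 m d : odd d -> (d %| 2 ^ m)%N -> d = 1%N.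
Proof.
move=> od dm; apply/eqP; rewrite -dvdn1.
by rewrite -(Gauss_dvdr (n := 2 ^ m)) ?muln1 // coprimeXr ?coprimen2.
Qed.

(* If k = 2j + 1 then q = 2 j (j + 1), where j and j + 1 are powers of 2. *)
Lemma sq_eq_double_pow2_succ m q k :
  (q ^ 2 = 2 ^ m)%N -> (k ^ 2 = q.*2.+1)%N -> q = 4%N.
Proof.
move=> qm kq; have kodd : odd k by have := oddX k 2; rewrite kq /= odd_double.
have qj : q = (2 * (k./2 * k./2.+1))%N.
  by move: (odd_double_half k) kq; rewrite kodd; move: k./2 => j <-; nia.
have q_dvd : (q %| 2 ^ m)%N by rewrite -qm dvdn_exp.
have j_dvd : (k./2 %| 2 ^ m)%N.
  by apply: dvdn_trans q_dvd; rewrite qj mulnCA dvdn_mulr.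
have j1_dvd : (k./2.+1 %| 2 ^ m)%N.
  by apply: dvdn_trans q_dvd; rewrite qj mulnA dvdn_mull.
have [jodd|jeven] := boolP (odd k./2).
  by rewrite qj (odd_dvd_pow2 jodd j_dvd).
have [j0] : k./2.+1 = 1%N by apply: odd_dvd_pow2 j1_dvd.
by rewrite j0 dvd0n expn_eq0 in j_dvd.
Qed.

Lemma pow2_inj_sq m e : ((2 ^ e) ^ 2 = 2 ^ m)%N -> m = (e * 2)%N.
Proof. by rewrite -expnM => /expnI ->. Qed.

Lemma sqr_eq_natr (w : int) (q : nat) : w ^+ 2 = q%:R ^+ 2 -> w = q%:R \/ w = - q%:R.
Proof. by move/eqP; rewrite eqf_sqr => /orP[]/eqP; [left|right]. Qed.

(** * Characters of the group F_2^n and their orthogonality *)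

Section Fourier.

Variable n : nat.
Notation V := 'rV['F_2]_n.
Implicit Types (a x y z p d : V) (S : {set V}).

Lemma addvv x : x + x = 0.
Proof. by apply/rowP => i; rewrite !mxE; case: (F2_cases (x 0 i)) => ->; apply: val_inj. Qed.

Lemma addvK x y : x + (x + y) = y.
Proof. by rewrite addrA addvv add0r. Qed.

Lemma addv_eq0 x y : (x + y == 0) = (x == y).
Proof. by rewrite -(addvv x) (inj_eq (addrI x)) eq_sym. Qed.

Lemma addv_eq x y z : (x + y == z) = (y == x + z).
Proof. by rewrite -(inj_eq (addrI x)) addvK. Qed.

Definition chi a x : int := signF2 (dotp a x).

Lemma chiC a x : chi a x = chi x a.
Proof. by congr signF2; apply: eq_bigr => i _; rewrite mulrC. Qed.

Lemma chiDr a x y : chi a (x + y) = chi a x * chi a y.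
Proof.
rewrite /chi -signF2D /dotp -big_split; congr signF2; apply: eq_bigr => i _.
by rewrite mxE mulrDr.
Qed.

Lemma chi0 a : chi a 0 = 1.
Proof. by rewrite /chi /dotp big1 // => i _; rewrite mxE mulr0. Qed.

Lemma card_vec : #|{: V}| = (2 ^ n)%N.
Proof. by rewrite card_mx card_Fp // mul1n. Qed.

(** For a nonzero a, some coordinate a_i is 1, so translating x by the i-th unit vector negates the
    sum, which must then vanish. *)
Lemma sum_chi a : \sum_x chi a x = (a == 0)%:R * 2 ^+ n.
Proof.
have [->|a0] := eqVneq a 0.
  under eq_bigr do rewrite chiC chi0.
  by rewrite sumr_const card_vec mul1r natrX.
have [i ai] : exists i, a 0 i != 0.
  by apply/existsP; apply: contraNT a0 => /existsPn h; apply/eqP/rowP => i;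
     move/negPn/eqP: (h i) => ->; rewrite mxE.
have chiN : chi a (delta_mx 0 i) = -1.
  rewrite /chi /dotp (bigD1 i) //= big1 => [|j ji].
    by rewrite mxE !eqxx mulr1 addr0; case: (F2_cases (a 0 i)) ai => ->.
  by rewrite mxE (negPf ji) andbF mulr0.
have : \sum_x chi a x = - \sum_x chi a x.
  rewrite [LHS](reindex_inj (addrI (delta_mx 0 i))) /= -sumrN.
  by apply: eq_bigr => x _; rewrite chiDr chiN mulN1r.
by rewrite mul0r; lia.
Qed.

(** * Character sums of a set, inversion, and representation counts *)

Definition charsum S a : int := \sum_(x in S) chi a x.

Lemma charsum0 S : charsum S 0 = #|S|%:R.
Proof.
rewrite /charsum; under eq_bigr do rewrite chiC chi0.
by rewrite sumr_const.
Qed.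

Lemma charsum_inversion S p :
  \sum_a charsum S a * chi a p = (p \in S)%:R * 2 ^+ n.
Proof.
under eq_bigr do rewrite /charsum mulr_suml.
rewrite exchange_big /=.
under eq_bigr do (under eq_bigr do rewrite -chiDr chiC; rewrite sum_chi addv_eq0).
case: (boolP (p \in S)) => pS.
  rewrite (bigD1 p) //= eqxx big1 ?addr0 // => x /andP[_ /negPf ->].
  by rewrite mul0r.
rewrite mul0r big1 // => x xS; case: eqP => [xp|]; last by rewrite mul0r.
by rewrite -xp xS in pS.
Qed.

Definition rep2 S p : {set V * V} :=
  [set t | [&& t.1 \in S, t.2 \in S & t.1 + t.2 == p]].

Definition rep3 S p : {set V * V * V} :=
  [set t | [&& t.1.1 \in S, t.1.2 \in S, t.2 \in S & t.1.1 + t.1.2 + t.2 == p]].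

(** Expand the square and group the pairs by their sum: [charsum] squared is the Fourier transform
    of the count of two-fold representations. *)
Lemma charsum_sq S a : charsum S a ^+ 2 = \sum_p #|rep2 S p|%:R * chi a p.
Proof.
rewrite expr2 /charsum mulr_suml.
under eq_bigr do rewrite mulr_sumr.
rewrite pair_big /= (partition_big (fun t : V * V => t.1 + t.2) predT) //=.
apply: eq_bigr => p _.
under eq_bigr => t /andP[_ /eqP tp] do rewrite -chiDr tp.
rewrite sumr_const [RHS]mulr_natl; congr (_ *+ _).
by apply: eq_card => t; rewrite [LHS]inE inE -andbA.
Qed.

Lemma charsum_cube S a : charsum S a ^+ 3 = \sum_p #|rep3 S p|%:R * chi a p.
Proof.
have sq : charsum S a ^+ 2 =
    \sum_(t : V * V | (t.1 \in S) && (t.2 \in S)) chi a t.1 * chi a t.2.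
  rewrite expr2 {1}/charsum mulr_suml -(pair_big _ _ (fun x y => chi a x * chi a y)).
  by apply: eq_bigr => x _; rewrite mulr_sumr.
rewrite exprSr sq mulr_suml.
under eq_bigr do rewrite mulr_sumr.
rewrite pair_big /= (partition_big (fun t : V * V * V => t.1.1 + t.1.2 + t.2) predT) //=.
apply: eq_bigr => p _.
under eq_bigr => t /andP[_ /eqP tp] do rewrite -!chiDr tp.
rewrite sumr_const [RHS]mulr_natl; congr (_ *+ _).
by apply: eq_card => t; rewrite [LHS]inE inE -!andbA.
Qed.

Lemma sum_charsum_cube S p :
  \sum_a charsum S a ^+ 3 * chi a p = #|rep3 S p|%:R * 2 ^+ n.
Proof.
under eq_bigr do rewrite charsum_cube mulr_suml.
rewrite exchange_big /= (bigD1 p) //= [X in _ + X]big1 => [|x xp].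
  rewrite addr0; under eq_bigr do rewrite -mulrA -chiDr addvv chi0 mulr1.
  by rewrite sumr_const card_vec -[LHS]mulr_natr natrX.
under eq_bigr do rewrite -mulrA -chiDr chiC.
by rewrite -mulr_sumr sum_chi addv_eq0 (negPf xp) mul0r mulr0.
Qed.

Lemma card_rep2_0 S : #|rep2 S 0| = #|S|.
Proof.
rewrite -(card_imset _ (_ : injective (fun x => (x, x)))) => [|x y []//].
apply: eq_card => -[x y]; rewrite inE /= addv_eq0.
apply/and3P/imsetP => [[xS _ /eqP <-]|[z zS [-> ->]]]; [by exists x|by []].
Qed.

Lemma parseval S : \sum_a charsum S a ^+ 2 = #|S|%:R * 2 ^+ n.
Proof.
under eq_bigr do rewrite charsum_sq.
rewrite exchange_big /= (bigD1 0) //= [X in _ + X]big1 => [|x xp].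
  rewrite addr0; under eq_bigr do rewrite chi0 mulr1.
  by rewrite sumr_const card_vec -[LHS]mulr_natr natrX card_rep2_0.
by under eq_bigr do rewrite chiC; rewrite -mulr_sumr sum_chi (negPf xp) mul0r mulr0.
Qed.

(** * Representations by two and three elements of a Sidon set *)

Lemma gammaP S d :
  reflect (d != 0 /\ exists2 x, x \in S & d + x \in S) (gamma S d == 1).
Proof.
apply: (iffP idP) => [|[d0 [x xS dS]]]; rewrite /gamma; case: ifPn => //.
  move=> /andP[d0 /set0Pn[y]]; rewrite inE => /andP[/imsetP[x xS ->] dS] _.
  by split=> //; exists x.
rewrite d0 /= => /negPn/eqP/setP/(_ (d + x)).
by rewrite !inE dS andbT imset_f.
Qed.

(** The last term is 2 or 0 according to the value of [gamma]. If a nonzero d is x + (d + x) with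
    both summands in S, the Sidon property allows only these two summands, in either order; for d =
    0 the pairs are the diagonal ones. *)
Lemma card_rep2 S d : sidon S ->
  #|rep2 S d|%:R = (d == 0)%:R * #|S|%:R + (1 - signF2 (gamma S d)).
Proof.
move=> hS; have [->|d0] := eqVneq d 0.
  by rewrite card_rep2_0 /gamma eqxx mul1r subrr addr0.
rewrite mul0r add0r.
case: (boolP (gamma S d == 1)) => [/[dup] /gammaP[_ [x xS dS]] /eqP ->|g1].
  have xd : x != d + x by rewrite -addv_eq0 addrCA addvv addr0.
  suff -> : rep2 S d = [set (x, d + x); (d + x, x)].
    by rewrite cards2 xpair_eqE (negPf xd).
  apply/setP => -[y z]; rewrite !inE /= !xpair_eqE.
  apply/and3P/idP => [[yS zS /eqP yz]|].
    have yNz : y != z by rewrite -addv_eq0 yz.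
    have e : [set y; z] = [set x; d + x].
      by apply: hS => //; rewrite yz addrCA addvv addr0.
    have /set2P : y \in [set x; d + x] by rewrite -e set21.
    have -> : z = d + y by rewrite -yz addrAC addvv add0r.
    by case=> ->; rewrite !eqxx ?orbT // addvK eqxx orbT.
  case/orP => /andP[/eqP -> /eqP ->]; split=> //; first by rewrite addrCA addvv addr0.
  by rewrite -addrA addvv addr0.
have -> : gamma S d = 0 by case: (F2_cases (gamma S d)) g1 => ->.
suff -> : rep2 S d = set0 by rewrite cards0 subrr.
apply/setP => -[x y]; rewrite !inE /=; apply: contraNF g1 => /and3P[xS yS /eqP e].
by apply/gammaP; split=> //; exists x => //; rewrite -e addrAC addvv add0r.
Qed.

(** The Walsh transform kept in the integers, where the equations can be solved by integer
    arithmetic; [bentE] returns to the reals. *)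
Definition walshz (f : V -> 'F_2) a : int := \sum_x signF2 (f x) * chi a x.

Lemma charsum_walsh S a : sidon S ->
  charsum S a ^+ 2 = #|S|%:R + (a == 0)%:R * 2 ^+ n - walshz (gamma S) a.
Proof.
move=> hS; rewrite charsum_sq; under eq_bigr do rewrite card_rep2 // mulrDl mulrBl mul1r.
rewrite big_split /= sumrB sum_chi addrA; congr (_ + _ - _).
rewrite (bigD1 0) //= eqxx big1 => [|x /negPf ->]; last by rewrite !mul0r.
by rewrite chi0 mulr1 mul1r addr0.
Qed.

(** Two equal entries cancel and leave p as the third, against p outside S. So the entries are
    distinct, and each 3-subset with sum p is counted once per ordering. *)
Lemma card_rep3_notin S p : p \notin S -> #|rep3 S p| = (6 * mult S p)%N.
Proof.
move=> pS.
pose B := [set t : 3.-tuple V | [&& all [in S] t, uniq t & \sum_(x <- t) x == p]].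
have -> : #|rep3 S p| = #|B|.
  pose f (t : V * V * V) := [tuple t.1.1; t.1.2; t.2].
  have fI : injective f by move=> [[x y] z] [[x' y'] z'] [-> -> ->].
  rewrite -(card_imset _ fI); apply: eq_card => t.
  apply/imsetP/idP => [[[[x y] z]]|].
    rewrite !inE /= => /and4P[xS yS zS /eqP e] ->.
    rewrite /= !big_cons big_nil addr0 addrA e eqxx xS yS zS !andbT /= !inE negb_or.
    apply/andP; split; first (apply/andP; split).
    - by apply: contraNneq pS => xy; rewrite -e xy addvv add0r.
    - by apply: contraNneq pS => xy; rewrite -e xy addrAC addvv add0r.
    - by apply: contraNneq pS => xy; rewrite -e xy -addrA addvv addr0.
  case: t => -[|x [|y [|z [|//]]]] //= i; rewrite inE /= => /and3P[].
  move=> /and4P[xS yS zS _] _; rewrite !big_cons big_nil addr0 addrA => e.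
  by exists (x, y, z); [rewrite inE /= xS yS zS | apply: val_inj].
rewrite /mult mulnC -sum1_card.
(* Group the ordered triples by their underlying set. *)
rewrite (partition_big (fun t : 3.-tuple V => [set:: t])
  [in [set T : {set V} | [&& T \subset S, #|T| == 3%N & \sum_(x in T) x == p]]]) /=; last first.
  move=> t; rewrite !inE => /and3P[tS ut /eqP <-]; apply/and3P; split.
  - by apply/subsetP => x; rewrite inE; apply: (allP tS).
  - by rewrite cardsE (card_uniqP ut) size_tuple.
  - by rewrite big_uniq //=; apply/eqP; apply: eq_bigl => x; rewrite inE.
rewrite -sum_nat_const; apply: eq_bigr => T; rewrite inE => /and3P[TS /eqP T3 /eqP Tp].
have <- : #|[set t : 3.-tuple V | all [in T] t & uniq t]| = 6%N.
  by rewrite card_uniq_tuples T3.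
rewrite sum1_card; apply: eq_card => t; rewrite [LHS]inE !inE.
apply/idP/idP => [/andP[/and3P[_ -> _] /eqP <-]|/andP[tT ut]].
  by rewrite andbT; apply/allP => x; rewrite inE.
have tE : [set:: t] = T.
  apply/eqP; rewrite eqEcard T3 cardsE (card_uniqP ut) size_tuple leqnn andbT.
  by apply/subsetP => x; rewrite inE; apply: (allP tT).
rewrite tE eqxx andbT ut /=; apply/andP; split.
  by apply/allP => x /(allP tT) xT; apply: (subsetP TS).
by rewrite -Tp big_uniq //= -tE; apply/eqP; apply: eq_bigl => x; rewrite inE.
Qed.

(** If x + y + z = p with x, y distinct, then x + y = z + p and the Sidon property puts p among x,
    y. So every triple consists of p and a repeated element. The three positions of p give families
    of size s that share only (p, p, p), whence 3s - 2. *)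
Lemma card_rep3_in S p : sidon S -> p \in S -> (#|rep3 S p| + 2 = 3 * #|S|)%N.
Proof.
move=> hS pS.
pose A := [set (p, x, x) | x in S]; pose B := [set (x, p, x) | x in S].
pose C := [set (x, x, p) | x in S].
have cA : #|A| = #|S| by apply: card_imset => x y [].
have cB : #|B| = #|S| by apply: card_imset => x y [].
have cC : #|C| = #|S| by apply: card_imset => x y [].
have rE : rep3 S p = A :|: B :|: C.
  apply/setP => -[[x y] z]; rewrite !inE /=.
  apply/and4P/idP => [[xS yS zS /eqP e]|].
    have [xy|xy] := eqVneq x y.
      have zp : z = p by rewrite -e xy addvv add0r.
      by apply/orP; right; apply/imsetP; exists x; rewrite // zp xy.
    have [zp|zp] := eqVneq z p.
      have /eqP : x + y == 0 by rewrite -(inj_eq (addIr z)) e zp add0r.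
      by move/eqP; rewrite addv_eq0 (negPf xy).
    have es : [set x; y] = [set z; p].
      by apply: hS => //; rewrite -e (addrC _ z) addvK.
    have : p \in [set x; y] by rewrite es set22.
    case/set2P => pE; apply/orP; left; apply/orP; [left|right]; apply/imsetP.
      move/eqP: e; rewrite -pE -addrA addv_eq addvv addv_eq0 => /eqP <-.
      by exists y.
    move/eqP: e; rewrite -pE -addrA addrCA addv_eq addvv addv_eq0 => /eqP <-.
    by exists x.
  case/orP => [/orP[]|] /imsetP[w wS [-> -> ->]]; split=> //.
  - by rewrite -addrA addvv addr0.
  - by rewrite addrAC addvv add0r.
  - by rewrite addvv add0r.
have iAB : A :&: B = [set (p, p, p)].
  apply/setP => t; rewrite !inE; apply/andP/eqP => [[/imsetP[x _ ->] /imsetP[y _ [-> <-]]]//|->].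
  by split; apply/imsetP; exists p.
have iC : (A :|: B) :&: C = [set (p, p, p)].
  apply/setP => t; rewrite !inE; apply/andP/eqP => [[]|->].
    by case/orP => /imsetP[x _ ->] /imsetP[y _ []] => [<- <-|<- <-].
  by split; [apply/orP; left|]; apply/imsetP; exists p.
have := cardsUI (A :|: B) C; have := cardsUI A B.
rewrite iAB iC !cards1 -rE cA cB cC.
by move: #|_ :|: _| #|rep3 S p| #|S| => u v w; lia.
Qed.

(** * Bentness, cardinality and the cover property *)

Lemma affdim_lt_card S : affdim S < #|S|%:Z.
Proof.
rewrite /affdim ltrBlDr -PoszD ltz_nat addn1 ltnS.
by apply/bigmax_leqP => A /andP[AS _]; apply: subset_leq_card.
Qed.

Lemma card_of_bent S : n != 2%N -> n != 4%N -> sidon S -> S != set0 ->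
    (forall a, walshz (gamma S) a ^+ 2 = 2 ^+ n) ->
  (#|S| ^ 2 = 2 ^ n)%N.
Proof.
move=> n2 n4 hS; rewrite -card_gt0 => S0 W2.
pose q := absz (walshz (gamma S) 0).
have q2 : (q ^ 2 = 2 ^ n)%N.
  by apply: (mulrIn (oner_neq0 int)); rewrite !natrX -(W2 0) natz abszE real_normK ?num_real.
have q0 : (0 < q)%N by move: (expn_gt0 2 n); rewrite -q2 expn_gt0 orbF.
have q2z : 2 ^+ n = q%:R ^+ 2 :> int by rewrite -!natrX q2.
have Wq a : walshz (gamma S) a = q%:R \/ walshz (gamma S) a = - q%:R.
  by apply: sqr_eq_natr; rewrite W2.
have [sq|sq] : #|S| = q \/ #|S| = q.+1.
  (* At a = 0 this reads s(s - 1) = q(q - 1) or s(s - 1) = q(q + 1), with s positive. *)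
  have := charsum_walsh 0 hS; rewrite eqxx mul1r charsum0 q2z.
  by case: (Wq 0) => ->; move: #|S| S0 => s s0; nia.
  by rewrite sq.
have Fq a : a != 0 -> charsum S a ^+ 2 = 1 \/ charsum S a ^+ 2 = q.*2.+1%:R.
  move=> /negPf a0; rewrite charsum_walsh // a0 mul0r addr0 sq.
  by case: (Wq a) => ->; [left|right]; lia.
have F1 a : a != 0 -> charsum S a ^+ 2 = 1.
  move=> /Fq[//|Fa].
  have q4 : q = 4%N.
    apply: (sq_eq_double_pow2_succ (k := absz (charsum S a)) q2).
    by apply: (mulrIn (oner_neq0 int)); rewrite !natrX -Fa natz abszE real_normK ?num_real.
  by move: n4; rewrite (@pow2_inj_sq n 2) ?eqxx // -q2 q4.
(* Parseval now says (q + 1)^2 + (q^2 - 1) = (q + 1) q^2; dividing by q(q + 1) gives q = 2, hence n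
   = 2. *)
have := parseval S; rewrite (bigD1 0) //= (eq_bigr _ F1) charsum0 sq q2z.
rewrite sumr_const cardC1 card_vec -q2 => e.
have q2E : q = 2%N by nia.
by move: n2; rewrite (@pow2_inj_sq n 1) ?eqxx // -q2 q2E.
Qed.

Lemma mult_of_bent S p : sidon S -> (#|S| ^ 2 = 2 ^ n)%N ->
    (forall a, walshz (gamma S) a ^+ 2 = 2 ^+ n) ->
  p \notin S -> (6 * mult S p + 2 = #|S|)%N.
Proof.
move=> hS s2 W2 pS; rewrite -card_rep3_notin //.
have s2z : 2 ^+ n = #|S|%:R ^+ 2 :> int by rewrite -!natrX s2.
(* The term at a = 0 corrects s^3 to 2s^2, so that one formula holds at every a. *)
have F3 a : charsum S a ^+ 3 = (a == 0)%:R * (#|S|%:R ^+ 3 - 2 * #|S|%:R ^+ 2)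
    + 2 * #|S|%:R * charsum S a.
  have [->|/negPf a0] := eqVneq a 0; first by rewrite charsum0 mul1r; ring.
  have : charsum S a ^+ 2 = 0 \/ charsum S a ^+ 2 = 2 * #|S|%:R.
    rewrite charsum_walsh // a0 mul0r addr0.
    have : walshz (gamma S) a ^+ 2 = #|S|%:R ^+ 2 by rewrite W2.
    by case/sqr_eq_natr => ->; [left|right]; ring.
  rewrite mul0r add0r => -[/eqP|F2]; last by rewrite exprSr F2.
  by rewrite expf_eq0 /= => /eqP ->; rewrite expr0n mulr0.
have := sum_charsum_cube S p.
under eq_bigr do rewrite F3 mulrDl -!mulrA.
rewrite big_split /= -!mulr_sumr charsum_inversion (negPf pS) mul0r !mulr0 addr0.
rewrite (bigD1 0) //= eqxx big1 => [|a /negPf ->]; last by rewrite mul0r.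
rewrite chiC chi0 s2z; have := expn_gt0 2 n; rewrite -s2 expn_gt0 orbF /=.
(* What is left is s^3 - 2s^2 = r s^2 with s positive. *)
move: #|rep3 S p| #|S| => r s. nia.
Qed.

Lemma bent_of_cover S k : (#|S| ^ 2 = 2 ^ n)%N -> is_cover k S ->
  forall a, walshz (gamma S) a ^+ 2 = 2 ^+ n.
Proof.
move=> s2 [hS k0 hk] a.
have s2z : 2 ^+ n = #|S|%:R ^+ 2 :> int by rewrite -!natrX s2.
have W b : walshz (gamma S) b = #|S|%:R + (b == 0)%:R * 2 ^+ n - charsum S b ^+ 2.
  by rewrite charsum_walsh //; ring.
have [->|a0] := eqVneq a 0; first by rewrite W eqxx charsum0 s2z mul1r; ring.
(* The excess of the number of ordered representations of a point of S over that of a point outside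
   S. *)
pose c : int := 3 * #|S|%:R - 2 - 6 * k%:R.
have rep3E p : #|rep3 S p|%:R = 6 * k%:R + (p \in S)%:R * c.
  have [pS|pS] := boolP (p \in S); last by rewrite card_rep3_notin // hk // /=; lia.
  by have := card_rep3_in hS pS; rewrite /c; move: #|rep3 S p| #|S| => r s; lia.
have F3 b : charsum S b ^+ 3 = (b == 0)%:R * (6 * k%:R * 2 ^+ n) + c * charsum S b.
  rewrite charsum_cube; under eq_bigr do rewrite rep3E mulrDl -mulrA.
  rewrite big_split /= -!mulr_sumr sum_chi; congr (_ + _); first by ring.
  rewrite /charsum mulr_sumr [RHS]big_mkcond; apply: eq_bigr => p _.
  by case: ifP => _; rewrite ?mul1r ?mul0r.
(* If s = 1 then n = 0, and the nonzero a could not exist. *)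
have sn1 : #|S| != 1%N.
  apply: contraNneq a0 => s1; apply/eqP/rowP => i.
  have n0 : n = 0%N by apply: (@expnI 2); rewrite // -s2 s1.
  by have := ltn_ord i; rewrite {2}n0.
(* At 0 the cubic relation becomes (s - 1)(s - 2) = 6k(s - 1), and s - 1 can be cancelled. Then c =
   2s. *)
have kE : 6 * k%:R = #|S|%:R - 2 :> int.
  have := F3 0; rewrite eqxx charsum0 s2z /c.
  have := expn_gt0 2 n; rewrite -s2 expn_gt0 orbF /=.
  by move: #|S| sn1 => s; nia.
have := F3 a; rewrite (negPf a0) mul0r add0r /c kE => Fa.
rewrite W (negPf a0) s2z mul0r addr0.
have : charsum S a * (charsum S a ^+ 2 - 2 * #|S|%:R) = 0.
  by rewrite mulrBr -exprS Fa; ring.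
move/eqP; rewrite mulf_eq0 subr_eq0 => /orP[]/eqP ->; ring.
Qed.

(** * Passage between integer and real conditions *)

Variable R : realType.

Lemma pow2half_ge0 : 0 <= pow2half R n.
Proof. exact: powR_ge0. Qed.

Lemma sqr_pow2half : pow2half R n ^+ 2 = 2 ^+ n.
Proof. by rewrite -powR_mulrn ?pow2half_ge0 // -powRrM divfK ?pnatr_eq0 // powR_mulrn. Qed.

(** Both sides of the bentness equation are nonnegative, so squaring loses nothing; it removes the
    absolute value and the possibly irrational 2^(n/2). *)
Lemma bentE (f : V -> 'F_2) :
  bent R f <-> forall a, walshz f a ^+ 2 = 2 ^+ n.
Proof.
have wE a : walsh R f a = (walshz f a)%:~R.
  rewrite /walshz rmorph_sum; apply: eq_bigr => x _.
  by rewrite /chi -signF2D rmorphXn /= rmorphN1.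
split=> h a.
  apply: (@intr_inj R); rewrite rmorphXn /= -wE -[LHS]real_normK ?num_real // h.
  by rewrite sqr_pow2half rmorphXn.
apply/eqP; rewrite -(eqrXn2 (n := 2)) ?pow2half_ge0 // real_normK ?num_real //.
by rewrite wE -rmorphXn /= h sqr_pow2half rmorphXn.
Qed.

Lemma natr_eq_pow2half (s : nat) : s%:R = pow2half R n <-> (s ^ 2 = 2 ^ n)%N.
Proof.
split=> [e|e].
  by apply: (mulrIn (oner_neq0 R)); rewrite !natrX e sqr_pow2half.
apply/eqP; rewrite -(eqrXn2 (n := 2)) ?pow2half_ge0 // sqr_pow2half.
by rewrite -!natrX e.
Qed.

End Fourier.

(* The iff fails at n = 2 and n = 4 (S the zero vector and the unit vectors is
   Sidon with gamma_S bent, but has n + 1 <> 2^(n/2) elements).  The final claim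
   fails at n = 0, where (2^(n/2) - 2) / 6 = - 1/6. *)
Theorem theorem4p12 (R : realType) (n : nat) (S : {set 'rV['F_2]_n})
    (hn2 : n != 2%N) (hn4 : n != 4%N)
    (hS : sidon S) (hdim : affdim S = n%:Z) :
  (bent R (gamma S) <->
     #|S|%:R = pow2half R n /\ exists k : nat, is_cover k S)
  /\ ((0 < n)%N -> bent R (gamma S) ->
     exists k : nat, k%:R = (pow2half R n - 2) / 6 /\ is_cover k S).
Proof.
(* The empty set has dimension -1, which is not a natural number n. *)
have S0 : S != set0.
  by have := affdim_lt_card S; rewrite hdim ltz_nat -card_gt0; apply: leq_ltn_trans.
have cover : (0 < n)%N -> bent R (gamma S) ->
     exists k : nat, k%:R = (pow2half R n - 2) / 6 /\ is_cover k S.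
  move=> n0 /bentE W2; have s2 := card_of_bent hn2 hn4 hS S0 W2.
  have hmult p pS := @mult_of_bent n S p hS s2 W2 pS.
  have s1 : (1 < #|S|)%N.
    by rewrite -(ltn_exp2r 1 _ (e := 2)) // s2 exp1n -(expn0 2) ltn_exp2l.
  (* Since s > 1, s < s^2 = 2^n, so S is not the whole space. *)
  have [p pS] : exists p, p \notin S.
    have : [set: 'rV['F_2]_n] :\: S != set0.
      by rewrite -card_gt0 cardsDS ?subsetT // cardsT card_vec -s2 subn_gt0; nia.
    by case/set0Pn => p; rewrite !inE andbT; exists p.
  exists (mult S p); split.
    have /natr_eq_pow2half <- := s2.
    by rewrite -(hmult p pS) natrD natrM; field.
  split=> // [|p' p'S]; last by have := hmult p' p'S; have := hmult p pS; lia.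
  (* Multiplicity 0 would mean s = 2, that is n = 2. *)
  rewrite lt0n; apply: contraNneq hn2 => m0; have := hmult p pS; rewrite m0 => s2E.
  by apply/eqP/(@pow2_inj_sq n 1); rewrite -s2 -s2E.
split=> //; split=> [hb|[/natr_eq_pow2half s2 [k hk]]]; last by apply/bentE/(bent_of_cover s2 hk).
split; first by apply/natr_eq_pow2half/(card_of_bent hn2 hn4 hS S0)/(@bentE n R).
(* For n = 0 the nonempty S is the whole one-point space, so the cover condition is vacuous and any
   positive k, such as 1, serves. *)
have [n0|n0] := posnP n; last by have [k [_ hk]] := cover n0 hb; exists k.
exists 1%N; split=> // p; have [x xS] := set0Pn _ S0.
suff -> : p = x by rewrite xS.
by apply/rowP => i; have := ltn_ord i; rewrite {2}n0.
Qed.
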